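(* Let $r$ be a positive integer, $s$ a nonnegative integer, $k\in\mathbb Z$, and $a_1,\dots,a_r$ nonzero complex numbers. Then for every integer $n\ge0$, $$S_n^{(r,k)}(x|a_1,\dots,a_r)=\sum_{m=0}^n\left(\binom{n}{m}\sum_{l=0}^{n-m}\frac{\binom{n-m}{l}}{\binom{l+s}{l}}S_2(l+s,s)S_{n-m-l}^{(r,k)}(a_1,\dots,a_r)\right)\mathfrak B_m^{(s)}(x).$$
   Context: For an integer $k$, ${\rm Li}_k(x)=\sum_{m=1}^\infty x^m/m^k$. For $r\in\mathbb Z_{>0}$, $k\in\mathbb Z$ and nonzero complex $a_1,\dots,a_r$, the polynomials $S_n^{(r,k)}(x|a_1,\dots,a_r)$ are defined by $\frac{t^r}{\prod_{j=1}^r(e^{a_jt}-1)}\frac{{\rm Li}_k(1-e^{-t})}{1-e^{-t}}e^{xt}=\sum_{n\ge0}S_n^{(r,k)}(x|a_1,\dots,a_r)\frac{t^n}{n!}$, and $S_n^{(r,k)}(a_1,\dots,a_r):=S_n^{(r,k)}(0|a_1,\dots,a_r)$. The Bernoulli polynomials of order $s$ are defined by $\left(\frac{t}{e^t-1}\right)^se^{xt}=\sum_{n\ge0}\mathfrak B_n^{(s)}(x)\frac{t^n}{n!}$. $S_2(l,m)$ are the Stirling numbers of the second kind: $(e^t-1)^m=m!\sum_{l\ge m}S_2(l,m)\frac{t^l}{l!}$. *)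

(* Defs.v *)
From HB Require Import structures.
From mathcomp Require Import all_boot all_order all_algebra.
From mathcomp Require Import boolp reals.
From mathcomp.real_closed Require Export complex.

Set Implicit Arguments.
Unset Strict Implicit.
Unset Printing Implicit Defensive.

Import Order.TTheory GRing.Theory Num.Theory.
Local Open Scope ring_scope.

(* Formal power series in an indeterminate t.  A record is used instead of
   nat -> A because the latter already carries pointwise operations. *)
Record fps (A : Type) := FPS { fcoef :> nat -> A }.

Lemma fpsP (A : Type) (f g : fps A) : f =1 g -> f = g.
Proof. by case: f => f; case: g => g /= /funext ->. Qed.

HB.instance Definition _ (A : Type) := gen_eqMixin (fps A).
HB.instance Definition _ (A : Type) := gen_choiceMixin (fps A).

Section FpsZmod.
Variable A : zmodType.
Implicit Types f g h : fps A.

Definition fps_zero : fps A := FPS (fun=> 0).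
Definition fps_opp f : fps A := FPS (fun n => - f n).
Definition fps_add f g : fps A := FPS (fun n => f n + g n).

Fact fps_addA : associative fps_add.
Proof. by move=> f g h; apply: fpsP => n /=; rewrite addrA. Qed.
Fact fps_addC : commutative fps_add.
Proof. by move=> f g; apply: fpsP => n /=; rewrite addrC. Qed.
Fact fps_add0 : left_id fps_zero fps_add.
Proof. by move=> f; apply: fpsP => n /=; rewrite add0r. Qed.
Fact fps_addN : left_inverse fps_zero fps_opp fps_add.
Proof. by move=> f; apply: fpsP => n /=; rewrite addNr. Qed.

HB.instance Definition _ :=
  GRing.isZmodule.Build (fps A) fps_addA fps_addC fps_add0 fps_addN.

Lemma fcoef0 n : (0 : fps A) n = 0. Proof. by []. Qed.
Lemma fcoefD f g n : (f + g) n = f n + g n. Proof. by []. Qed.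
Lemma fcoefN f n : (- f) n = - f n. Proof. by []. Qed.
Lemma fcoefB f g n : (f - g) n = f n - g n. Proof. by []. Qed.

Lemma fcoef_sum (I : Type) (r : seq I) (P : pred I) (F : I -> fps A) n :
  (\sum_(i <- r | P i) F i) n = \sum_(i <- r | P i) F i n.
Proof. by elim/big_rec2: _ => // i x y _ <-. Qed.
End FpsZmod.

Section FpsRing.
Variable A : comNzRingType.
Implicit Types f g h : fps A.

Definition fps_one : fps A := FPS (fun n => (n == 0)%:R).
Definition fps_mul f g : fps A :=
  FPS (fun n => \sum_(i < n.+1) f i * g (n - i)%N).

Let trunc N f : {poly A} := \poly_(i < N) f i.

Let fps_mulE f g N n : (n < N)%N -> fps_mul f g n = (trunc N f * trunc N g)`_n.
Proof.
move=> ltnN; rewrite coefM; apply: eq_bigr => -[i /= lti] _.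
rewrite !coef_poly (leq_ltn_trans (leq_subr _ _) ltnN).
by rewrite (leq_ltn_trans _ ltnN).
Qed.

Fact fps_mulC : commutative fps_mul.
Proof.
by move=> f g; apply: fpsP => n; rewrite !(@fps_mulE _ _ n.+1) // mulrC.
Qed.

Fact fps_mulA : associative fps_mul.
Proof.
move=> f g h; apply: fpsP => n.
have step u v w : fps_mul (fps_mul u v) w n =
    (trunc n.+1 u * trunc n.+1 v * trunc n.+1 w)`_n.
  rewrite coefM /=; apply: eq_bigr => -[i /= lti] _.
  by rewrite -fps_mulE // coef_poly ltnS leq_subr.
by rewrite step fps_mulC step mulrC mulrA.
Qed.

Fact fps_mul1 : left_id fps_one fps_mul.
Proof.
move=> f; apply: fpsP => n /=; rewrite big_ord_recl mul1r subn0 big1 ?addr0 //.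
by move=> i _; rewrite mul0r.
Qed.

Fact fps_mulDl : left_distributive fps_mul +%R.
Proof.
move=> f g h; apply: fpsP => n /=.
by rewrite -big_split /=; apply: eq_bigr => i _; rewrite mulrDl.
Qed.

Fact fps_one_neq0 : fps_one != 0.
Proof.
by apply/eqP => /(congr1 (fun f : fps A => f 0))/eqP; rewrite /= oner_eq0.
Qed.

HB.instance Definition _ := GRing.Zmodule_isComNzRing.Build (fps A)
  fps_mulA fps_mulC fps_mul1 fps_mulDl fps_one_neq0.

Lemma fcoef1 n : (1 : fps A) n = (n == 0)%:R. Proof. by []. Qed.
Lemma fcoefM f g n : (f * g) n = \sum_(i < n.+1) f i * g (n - i)%N.
Proof. by []. Qed.

Definition fpsC (c : A) : fps A := FPS (fun n => if n == 0 then c else 0).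
Definition fpsT : fps A := FPS (fun n => (n == 1)%:R).

(* The quotient of f by t, for f without constant term. *)
Definition divT f : fps A := FPS (fun n => f n.+1).

(* Substitution g(f(t)), for f without constant term: the m-th power of f then
   starts at t^m, so m <= n suffices for the coefficient of t^n. *)
Definition fps_comp g f : fps A := FPS (fun n => \sum_(m < n.+1) g m * (f ^+ m) n).

Lemma fpsCM c f n : (fpsC c * f) n = c * f n.
Proof.
rewrite fcoefM big_ord_recl subn0 big1 ?addr0 // => i _.
by rewrite /= mul0r.
Qed.

Lemma fpsTM f n : (fpsT * f) n = if n is m.+1 then f m else 0.
Proof.
case: n => [|n]; rewrite fcoefM; first by rewrite big_ord1 mul0r.
rewrite big_ord_recl mul0r add0r big_ord_recl mul1r big1 ?addr0 ?subn1 //.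
by move=> i _; rewrite /= mul0r.
Qed.

Lemma divTK f : f 0 = 0 -> fpsT * divT f = f.
Proof. by move=> f0; apply: fpsP => -[|n]; rewrite fpsTM. Qed.

Lemma fcoefX_small f m n : f 0 = 0 -> (n < m)%N -> (f ^+ m) n = 0.
Proof.
move=> f0; elim: m n => // m IHm n; rewrite ltnS => lenm.
rewrite exprS fcoefM big_ord_recl f0 mul0r add0r big1 // => -[i /= lti] _.
rewrite IHm ?mulr0 // /bump /= add1n.
by case: n lenm lti => // n lenm _; rewrite subSS (leq_ltn_trans (leq_subr _ _)).
Qed.

Lemma fps_comp_widen g f N n :
  f 0 = 0 -> (n <= N)%N -> fps_comp g f n = \sum_(m < N.+1) g m * (f ^+ m) n.
Proof.
move=> f0 lenN; rewrite /= (big_ord_widen N.+1 (fun m => g m * (f ^+ m) n)) //.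
rewrite [RHS](bigID (fun m : 'I_N.+1 => m < n.+1)%N) /=.
rewrite [X in _ = _ + X]big1 ?addr0 // => m.
by rewrite -leqNgt => ltnm; rewrite fcoefX_small ?mulr0.
Qed.

Lemma fps_comp_divT g f :
  g 0 = 0 -> f 0 = 0 -> f * fps_comp (divT g) f = fps_comp g f.
Proof.
move=> g0 f0; apply: fpsP => n; rewrite fcoefM.
under eq_bigr => i _ do rewrite (@fps_comp_widen _ _ n) ?leq_subr // mulr_sumr.
rewrite exchange_big [RHS](@fps_comp_widen _ _ n.+1) //.
rewrite [RHS]big_ord_recl g0 mul0r add0r.
apply: eq_bigr => m _; rewrite exprS fcoefM mulr_sumr.
by apply: eq_bigr => i _; rewrite mulrCA.
Qed.

Definition fps_geom : fps A := FPS (fun=> 1).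

Lemma fps_geomP f : f 0 = 0 -> fps_comp fps_geom f * (1 - f) = 1.
Proof.
move=> f0; rewrite mulrBr mulr1; apply/eqP; rewrite subr_eq; apply/eqP.
rewrite mulrC; have -> : f * fps_comp fps_geom f = fps_comp (fps_geom - 1) f.
  rewrite -[RHS]fps_comp_divT ?fcoefB ?fcoef1 ?subrr //.
  congr (_ * fps_comp _ _).
  by apply: fpsP => n; rewrite /= subr0.
apply: fpsP => n; rewrite fcoefD /= !big_ord_recl /= subrr mul0r mul1r.
by rewrite add0r; congr (_ + _); apply: eq_bigr => i _; rewrite /= subr0.
Qed.
End FpsRing.

Arguments fpsT {A}.

Section FpsUnitRing.
Variable A : comUnitRingType.
Implicit Types f g : fps A.

Definition fps_unit : {pred fps A} := fun f => f 0 \is a GRing.unit.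

(* 1 / f = c / (1 - (1 - c f)) with c = 1 / f(0), expanded geometrically. *)
Definition fps_inv f : fps A :=
  if f \in fps_unit then
    fpsC (f 0)^-1 * fps_comp (fps_geom A) (1 - fpsC (f 0)^-1 * f)
  else f.

Fact fps_mulVx : {in fps_unit, left_inverse 1 fps_inv *%R}.
Proof.
move=> f Uf; rewrite /fps_inv Uf mulrAC mulrC.
set h := fpsC _ * f; have h0 : (1 - h) 0 = 0.
  by rewrite fcoefB fcoef1 fpsCM mulVr ?subrr.
by rewrite -[RHS](fps_geomP h0) subKr.
Qed.

Fact fps_unitPl f g : g * f = 1 -> fps_unit f.
Proof.
move=> /(congr1 (fun h : fps A => h 0)); rewrite fcoefM big_ord1 subn0 => gf1.
by apply/unitrP; exists (g 0); split; rewrite ?[f 0 * _]mulrC; exact: gf1.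
Qed.

Fact fps_inv_out : {in [predC fps_unit], fps_inv =1 id}.
Proof. by move=> f /negbTE Uf; rewrite /fps_inv ifN // Uf. Qed.

HB.instance Definition _ := GRing.ComNzRing_hasMulInverse.Build (fps A)
  fps_mulVx fps_unitPl fps_inv_out.

Lemma fps_unitE f : (f \is a GRing.unit) = (f 0 \is a GRing.unit).
Proof. by []. Qed.

(* The exponential e^{ct}. *)
Definition expT (c : A) : fps A := FPS (fun n => c ^+ n / n`!%:R).

Definition egf (u : nat -> A) : fps A := FPS (fun n => u n / n`!%:R).

Definition egf_coef f (n : nat) : A := n`!%:R * f n.

Definition polylog (k : int) : fps A :=
  FPS (fun m => if m == 0 then 0 else m%:R ^ (- k)).

(* The series t / (e^{ct} - 1), meaningful when c is a unit. *)
Definition texp (c : A) : fps A := (divT (expT c - 1))^-1.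

(* The series Li_k(1 - e^{-t}) / (1 - e^{-t}): the series Li_k(u) / u at
   u = 1 - e^{-t}. *)
Definition polylog_quot (k : int) : fps A :=
  fps_comp (divT (polylog k)) (1 - expT (-1)).

Lemma texpP c : c \is a GRing.unit -> (expT c - 1) * texp c = fpsT.
Proof.
move=> Uc; rewrite -{1}[expT c - 1]divTK; last first.
  by rewrite fcoefB /= expr0 divr1 subrr.
rewrite -mulrA mulrV ?mulr1 // fps_unitE /= subr0.
by rewrite expr1 divr1.
Qed.

Lemma polylog_quotP k :
  (1 - expT (-1)) * polylog_quot k = fps_comp (polylog k) (1 - expT (-1)).
Proof.
by rewrite /polylog_quot fps_comp_divT // fcoefB fcoef1 /= expr0 divr1 subrr.
Qed.

Lemma egf_coefK f : (forall n, n`!%:R \is a @GRing.unit A) -> egf (egf_coef f) = f.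
Proof. by move=> U; apply: fpsP => n; rewrite /= /egf_coef mulrAC mulrV ?mul1r. Qed.
End FpsUnitRing.

Section Polynomials.
Variable F : numFieldType.

(* The generating functions involving e^{xt} are power series over {poly F},
   with x the polynomial variable 'X. *)
Definition S_poly (r : nat) (k : int) (a : 'I_r -> F) (n : nat) : {poly F} :=
  egf_coef ((\prod_(j < r) texp (a j)%:P) * polylog_quot {poly F} k * expT 'X) n.

Definition S_num (r : nat) (k : int) (a : 'I_r -> F) (n : nat) : F :=
  (S_poly k a n).[0].

Definition bernoulli_poly (s n : nat) : {poly F} :=
  egf_coef (texp 1 ^+ s * expT 'X) n.

Definition stirling2 (l m : nat) : F := egf_coef ((expT 1 - 1) ^+ m) l / m`!%:R.

Let fact_unit n : n`!%:R \is a @GRing.unit {poly F}.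
Proof.
by rewrite -polyC_natr poly_unitE coefC size_polyC pnatr_eq0 -lt0n fact_gt0
           unitfE pnatr_eq0 -lt0n fact_gt0.
Qed.

Lemma S_poly_gf (r : nat) (k : int) (a : 'I_r -> F) :
  (forall j, a j != 0) ->
  (\prod_(j < r) (expT (a j)%:P - 1)) * (1 - expT (-1)) * egf (S_poly k a) =
  fpsT ^+ r * fps_comp (polylog {poly F} k) (1 - expT (-1)) * expT 'X.
Proof.
move=> a0; rewrite [egf _]egf_coefK // mulrA; congr (_ * _).
rewrite mulrACA polylog_quotP -big_split /=; congr (_ * _).
under eq_bigr => j _.
  rewrite texpP; last by rewrite poly_unitE coefC size_polyC a0 unitfE a0.
  over.
by rewrite prodr_const card_ord.
Qed.

Lemma bernoulli_poly_gf (s : nat) :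
  (expT 1 - 1) ^+ s * egf (bernoulli_poly s) = fpsT ^+ s * expT 'X.
Proof.
by rewrite [egf _]egf_coefK // mulrA -exprMn texpP ?unitr1.
Qed.

Lemma stirling2_gf (m : nat) :
  (expT 1 - 1) ^+ m = fpsC m`!%:R * egf (fun l => stirling2 l m).
Proof.
apply: fpsP => l; rewrite fpsCM /= /stirling2 /egf_coef.
have nz n : n`!%:R != 0 :> F by rewrite pnatr_eq0 -lt0n fact_gt0.
by rewrite mulrA mulrCA mulrV ?unitfE // mulr1 mulrAC mulfV ?mul1r.
Qed.

Lemma stirling2_small (l m : nat) : (l < m)%N -> stirling2 l m = 0.
Proof.
move=> ltlm; rewrite /stirling2 /egf_coef fcoefX_small ?mulr0 ?mul0r //.
by rewrite fcoefB /= expr0 divr1 subrr.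
Qed.
End Polynomials.

(* Main.v *)
Require Import Defs.
From HB Require Import structures.
From mathcomp Require Import all_boot all_order all_algebra.
From mathcomp Require Import reals.

Set Implicit Arguments.
Unset Strict Implicit.
Unset Printing Implicit Defensive.

Import Order.TTheory GRing.Theory Num.Theory.
Local Open Scope ring_scope.

(** Let G(t) be the generating function of the numbers S_n(a_1, ..., a_r), and
    let H(t) = ((e^t - 1) / t)^s.  Since H (t / (e^t - 1))^s = 1, we have
    G e^{xt} = (H G) ((t / (e^t - 1))^s e^{xt}), whose last factor generates
    the Bernoulli polynomials of order s.  The coefficients of H are Stirling
    numbers of the second kind with indices shifted by s, and the theorem
    follows by comparing coefficients of t^n / n!.  The series G and H have
    constant coefficients: they are images of series over the base field F
    under F -> F[x], and evaluation at x = 0 gives them back. *)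

Section FpsMap.
Variables (A B : comNzRingType) (phi : {rmorphism A -> B}).

Definition fps_map (f : fps A) : fps B := FPS (fun n => phi (f n)).

Fact fps_map_is_zmod_morphism : zmod_morphism fps_map.
Proof. by move=> f g; apply: fpsP => n /=; rewrite rmorphB. Qed.

Fact fps_map_is_monoid_morphism : monoid_morphism fps_map.
Proof.
split=> [|f g]; apply: fpsP => n /=; first by rewrite rmorph_nat.
by rewrite rmorph_sum; apply: eq_bigr => i _; rewrite rmorphM.
Qed.

HB.instance Definition _ :=
  GRing.isZmodMorphism.Build (fps A) (fps B) fps_map fps_map_is_zmod_morphism.
HB.instance Definition _ :=
  GRing.isMonoidMorphism.Build (fps A) (fps B) fps_map
    fps_map_is_monoid_morphism.

Lemma fps_map_divT f : fps_map (divT f) = divT (fps_map f).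
Proof. by []. Qed.

(** Each coefficient of a composite is a finite sum, so [phi] passes through it. *)
Lemma fps_map_comp g f :
  fps_map (fps_comp g f) = fps_comp (fps_map g) (fps_map f).
Proof.
apply: fpsP => n /=; rewrite rmorph_sum; apply: eq_bigr => m _.
by rewrite rmorphM -rmorphXn.
Qed.
End FpsMap.

Section FpsMapUnit.
Variables (A B : comUnitRingType) (phi : {rmorphism A -> B}).
(** Morphisms commute with inversion at units; this covers [1 / n!] in [expT] and [m ^ (- k)] in
    [polylog]. *)
Hypothesis natr_unit : forall n, n.+1%:R \is a @GRing.unit A.

Lemma fact_unitr n : n`!%:R \is a @GRing.unit A.
Proof. by case: n`! (fact_gt0 n) => // m _; apply: natr_unit. Qed.

Lemma fps_map_expT c : fps_map phi (expT c) = expT (phi c).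
Proof.
apply: fpsP => n /=.
by rewrite rmorphM rmorphXn rmorphV ?fact_unitr //= rmorph_nat.
Qed.

Lemma divT_expT_unit (c : A) :
  c \is a GRing.unit -> divT (expT c - 1) \is a GRing.unit.
Proof. by rewrite fps_unitE /= subr0 expr1 divr1. Qed.

Lemma fps_map_texp c :
  c \is a GRing.unit -> fps_map phi (texp c) = texp (phi c).
Proof.
move=> Uc; rewrite rmorphV ?divT_expT_unit //=.
by rewrite fps_map_divT rmorphB rmorph1 /= fps_map_expT.
Qed.

Lemma fps_map_polylog k : fps_map phi (polylog A k) = polylog B k.
Proof.
apply: fpsP => -[|m] /=; first by rewrite rmorph0.
by rewrite rmorphXz //= rmorph_nat.
Qed.

Lemma fps_map_polylog_quot k :
  fps_map phi (polylog_quot A k) = polylog_quot B k.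
Proof.
rewrite /polylog_quot fps_map_comp fps_map_divT fps_map_polylog.
by rewrite rmorphB rmorph1 /= fps_map_expT rmorphN1.
Qed.

Lemma egf_coef_map f n : egf_coef (fps_map phi f) n = phi (egf_coef f n).
Proof. by rewrite /egf_coef rmorphM rmorph_nat. Qed.

(** Binomial convolution, from [n! = 'C(n, m) * m! * (n - m)!]. *)
Lemma egf_coefM (f g : fps A) n :
  egf_coef (f * g) n =
  \sum_(0 <= m < n.+1) 'C(n, m)%:R * egf_coef f m * egf_coef g (n - m).
Proof.
rewrite /egf_coef fcoefM mulr_sumr big_mkord; apply: eq_bigr => -[m /= lem] _.
by rewrite -(@bin_fact n m) // !natrM -mulrA mulrACA -[RHS]mulrA.
Qed.
End FpsMapUnit.

Section Expansion.
Variable F : numFieldType.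

Lemma natf_unit n : n.+1%:R \is a @GRing.unit F.
Proof. by rewrite unitfE pnatr_eq0. Qed.

Lemma polyC_unit (c : F) : c != 0 -> c%:P \is a GRing.unit.
Proof. by move=> c0; rewrite poly_unitE coefC size_polyC c0 unitfE. Qed.

Lemma natp_unit n : n.+1%:R \is a @GRing.unit {poly F}.
Proof. by rewrite -polyC_natr polyC_unit ?pnatr_eq0. Qed.

(** The series G, taken over [F] so that its coefficients are scalars. *)
Definition S_gf (r : nat) (k : int) (a : 'I_r -> F) : fps F :=
  (\prod_(j < r) texp (a j)) * polylog_quot F k.

Lemma S_polyE r k (a : 'I_r -> F) n : (forall j, a j != 0) ->
  S_poly k a n = egf_coef (fps_map polyC (S_gf k a) * expT 'X) n.
Proof.
move=> a0; rewrite /S_poly /S_gf rmorphM rmorph_prod /=.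
rewrite (fps_map_polylog_quot _ natf_unit); congr (egf_coef (_ * _ * _) n).
by apply: eq_bigr => j _; rewrite (fps_map_texp _ natf_unit) ?unitfE.
Qed.

(** Evaluation at 0 is a ring morphism that undoes [polyC] and sends e^{xt} to 1, so it can be
    applied to the whole series. *)
Lemma S_numE r k (a : 'I_r -> F) n : (forall j, a j != 0) ->
  S_num k a n = egf_coef (S_gf k a) n.
Proof.
move=> a0; rewrite /S_num S_polyE // -[LHS]/(horner_eval 0 _) -egf_coef_map.
rewrite rmorphM /= (fps_map_expT _ natp_unit) /= /horner_eval hornerX.
have -> : expT 0 = 1 :> fps F.
  by apply: fpsP => -[|m]; rewrite /= ?expr0 ?divr1 // exprS !mul0r.
rewrite mulr1; congr (egf_coef _ n); apply: fpsP => m /=.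
by rewrite /horner_eval hornerC.
Qed.

Lemma fpsTnM (A : comNzRingType) (f : fps A) s n :
  (fpsT ^+ s * f) (n + s)%N = f n.
Proof.
elim: s n => [|s IHs] n; first by rewrite mul1r addn0.
by rewrite exprS -mulrA fpsTM addnS.
Qed.

(** As (e^t - 1)^s = t^s H, the coefficient of t^l in H is that of t^(l+s) in (e^t - 1)^s; the
    binomial denominator comes from [(l + s)! = 'C(l + s, l) * l! * s!]. *)
Lemma stirling2E l s :
  egf_coef (divT (expT 1 - 1) ^+ s) l =
  stirling2 F (l + s) s / 'C(l + s, l)%:R.
Proof.
have nz m : m`!%:R != 0 :> F by rewrite pnatr_eq0 -lt0n fact_gt0.
have e0 : (expT 1 - 1 : fps F) 0 = 0 by rewrite fcoefB /= expr0 divr1 subrr.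
rewrite /stirling2 /egf_coef -{2}(divTK e0) exprMn fpsTnM.
rewrite -(bin_fact (leq_addr s l)) addKn !natrM.
have bz : 'C(l + s, l)%:R != 0 :> F by rewrite pnatr_eq0 -lt0n bin_gt0 leq_addr.
rewrite -['C(_, _)%:R * _ * _]mulrA ['C(_, _)%:R * _]mulrC.
by rewrite [_ * 'C(_, _)%:R / _]mulrAC mulfK // [_ * s`!%:R * _]mulrAC mulfK.
Qed.

Lemma S_poly_bernoulli r k (a : 'I_r -> F) s n : (forall j, a j != 0) ->
  S_poly k a n =
  \sum_(0 <= m < n.+1)
    ('C(n, m)%:R *
     \sum_(0 <= l < (n - m).+1)
       'C(n - m, l)%:R / 'C(l + s, l)%:R *
       stirling2 F (l + s) s * S_num k a (n - m - l))
    *: bernoulli_poly F s m.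
Proof.
move=> a0; pose H : fps F := divT (expT 1 - 1) ^+ s.
(* [texp 1] is by definition the inverse of [divT (expT 1 - 1)]. *)
have HV : fps_map polyC H * texp 1 ^+ s = 1.
  rewrite rmorphXn /= fps_map_divT rmorphB rmorph1 /=.
  rewrite (fps_map_expT _ natf_unit) rmorph1 -exprMn.
  by rewrite mulrV ?expr1n // divT_expT_unit ?unitr1.
(* The Bernoulli factor is put first so that the convolution index m falls on it. *)
have -> : S_poly k a n =
    egf_coef ((texp 1 ^+ s * expT 'X) * fps_map polyC (H * S_gf k a)) n.
  rewrite S_polyE //; congr (egf_coef _ n).
  by rewrite [in RHS]rmorphM mulrACA [texp 1 ^+ s * _]mulrC HV mul1r mulrC.
rewrite egf_coefM; apply: eq_bigr => m _.
(* The coefficients of the other factor are constants, which turns the product into a scaling; a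
   second convolution, over [F], expands H G. *)
rewrite egf_coef_map [egf_coef (H * _) _]egf_coefM
        -mul_polyC [in RHS]polyCM polyC_natr
        [LHS]mulrAC.
congr (_ * _%:P * _); apply: eq_bigr => l _.
by rewrite stirling2E -S_numE // [_ / _ * stirling2 _ _ _]mulrAC !mulrA.
Qed.
End Expansion.

Theorem theorem9 (R : realType) (r s : nat) (k : int) (a : 'I_r -> R[i])
    (r_gt0 : (0 < r)%N) (a_neq0 : forall j, a j != 0) (n : nat) :
  S_poly k a n =
  \sum_(0 <= m < n.+1)
    ('C(n, m)%:R *
     \sum_(0 <= l < (n - m).+1)
       'C(n - m, l)%:R / 'C(l + s, l)%:R *
       stirling2 R[i] (l + s) s * S_num k a (n - m - l))
    *: bernoulli_poly R[i] s m.
Proof. exact: S_poly_bernoulli. Qed.
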